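(* Let $M$ be a smooth manifold, $\nabla$ an affine connection on $M$, and $h$ a non-degenerate $(0,2)$-tensor field on $M$. Let $\hat\nabla$ and $\hat\nabla^*$ be the connections on $TM\oplus T^*M$ given by $$\hat\nabla_{X+\eta}(Y+\beta)=\nabla_XY+h(\nabla_X(h^{-1}(\beta))),\qquad \hat\nabla^*_{X+\eta}(Y+\beta)=h^{-1}(\nabla_X(h(Y)))+\nabla_X\beta,$$ and for $\alpha\in\mathbb{R}$ let $\hat\nabla^{(\alpha)}=\frac{1+\alpha}{2}\hat\nabla+\frac{1-\alpha}{2}\hat\nabla^*$. If $h$ is symmetric and $\nabla h=0$, then $$\operatorname{Ric}^{\hat\nabla^{(\alpha)}}(Y+\beta,Z+\gamma)=\operatorname{Ric}^\nabla(Y,Z)=\operatorname{Ric}^{\hat\nabla^{(-\alpha)}}(Y+\beta,Z+\gamma)$$ for all vector fields $Y,Z$, all $1$-forms $\beta,\gamma$ on $M$ and every $\alpha\in\mathbb{R}$; that is, $(TM\oplus T^*M,\check h,\hat\nabla^{(\alpha)},\hat\nabla^{(-\alpha)})$ is conjugate Ricci-symmetric.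
   Context: The tensor $h$ is identified with the bundle isomorphism $h:TM\to T^*M$, $h(X)=h(X,\cdot)$, with inverse $h^{-1}$. The connection $\nabla$ acts on $1$-forms by $(\nabla_X\beta)(Y)=X(\beta(Y))-\beta(\nabla_XY)$, and $R^\nabla(X,Y)=\nabla_X\nabla_Y-\nabla_Y\nabla_X-\nabla_{[X,Y]}$. On $TM\oplus T^*M$: the bracket is $[X+\eta,Y+\beta]_\nabla=[X,Y]+\nabla_X\beta-\nabla_Y\eta$; the bilinear form is $\check h(X+\eta,Y+\beta)=h(X,Y)+h(h^{-1}(\eta),h^{-1}(\beta))$; the curvature of a connection $D$ is $R^D(\sigma,\tau)\nu=D_\sigma D_\tau\nu-D_\tau D_\sigma\nu-D_{[\sigma,\tau]_\nabla}\nu$. For $h$ symmetric, let $\{E_i\}$ be a local $h$-orthonormal frame, $\varepsilon_i=h(E_i,E_i)\in\{1,-1\}$, and $e_i^{\pm}=\frac1{\sqrt2}(E_i\pm h(E_i))$, a $\check h$-orthonormal frame. Then $\operatorname{Ric}^\nabla(Y,Z)=\sum_i\varepsilon_i h(R^\nabla(E_i,Y)Z,E_i)$ and $\operatorname{Ric}^D(\sigma,\nu)=\sum_i\varepsilon_i\{\check h(R^D(e_i^+,\sigma)\nu,e_i^+)+\check h(R^D(e_i^-,\sigma)\nu,e_i^-)\}$. Two connections $D,D^*$ on $TM\oplus T^*M$ are dual with respect to $\check h$ if $X(\check h(\tau,\nu))=\check h(D_{X+\eta}\tau,\nu)+\check h(\tau,D^*_{X+\eta}\nu)$ for all $X,\eta$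 and sections $\tau,\nu$; the connections $\hat\nabla^{(\alpha)}$ and $\hat\nabla^{(-\alpha)}$ are dual in this sense when $h$ is symmetric. A dual pair $(\check h;D,D^* )$ is called conjugate Ricci-symmetric if $\operatorname{Ric}^{D}=\operatorname{Ric}^{D^*}$. *)

(* Defs.v *)
From HB Require Import structures.
From mathcomp Require Import all_boot all_order all_algebra ring.
From mathcomp Require Import all_classical all_reals all_analysis.

Set Implicit Arguments.
Unset Strict Implicit.
Unset Printing Implicit Defensive.

Import Order.TTheory GRing.Theory Num.Theory.
Import numFieldNormedType.Exports.

Local Open Scope classical_set_scope.
Local Open Scope ring_scope.

Section SmoothRn.
Variables (R : realType) (n : nat).
Implicit Types (V : set 'rV[R]_n) (g : 'rV[R]_n -> R) (k : nat).

(* [Ck k V g]: all iterated partial derivatives of g of order at most k exist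
   and are continuous at every point of the (open) set V. *)
Fixpoint Ck k V g : Prop :=
  (forall x, V x -> {for x, continuous g}) /\
  (if k is k'.+1 then
     forall i : 'I_n,
       (forall x, V x -> derivable g x (delta_mx 0 i)) /\
       Ck k' V (fun x => 'D_(delta_mx 0 i) g x)
   else True).

Definition Cinfty V g := forall k, Ck k V g.

Lemma CkE k V g : Ck k V g ->
  (forall x, V x -> {for x, continuous g}) /\
  (if k is k'.+1 then
     forall i : 'I_n,
       (forall x, V x -> derivable g x (delta_mx 0 i)) /\
       Ck k' V (fun x => 'D_(delta_mx 0 i) g x)
   else True).
Proof. by case: k. Qed.

Lemma CkW k V g : Ck k.+1 V g -> Ck k V g.
Proof.
elim: k g => [|k IH] g /= [cg H]; split => // i.
by have [dg Hg] := H i; split => //; apply: IH.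
Qed.

Lemma eq_Ck k V f g : open V -> (forall x, V x -> f x = g x) ->
  Ck k V f -> Ck k V g.
Proof.
move=> oV; have nV (u v : 'rV[R]_n -> R) : (forall x, V x -> u x = v x) ->
    forall x, V x -> \forall y \near x, u y = v y.
  by move=> uv x Vx; apply: (filterS uv); exact: open_nbhs_nbhs.
have cV (u v : 'rV[R]_n -> R) : (forall x, V x -> u x = v x) ->
    (forall x, V x -> {for x, continuous u}) ->
    forall x, V x -> {for x, continuous v}.
  move=> uv cu x Vx; rewrite /prop_for /continuous_at -uv//.
  apply: cvg_trans (cu x Vx).
  exact: (@near_eq_cvg _ _ (nbhs x) _ _ _ (nV u v uv x Vx)).
elim: k f g => [|k IH] f g fg /CkE[cf Hf]; split=> //; try exact: cV cf.
move=> i; have [df Df] := Hf i; split=> [x Vx|].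
  by apply: near_eq_derivable (df x Vx); exact: nV.
by apply: IH Df => x Vx; apply: near_eq_derive; exact: nV.
Qed.

Lemma Ck_cst k V (a : R) : open V -> Ck k V (fun=> a).
Proof.
move=> oV; elim: k a => [|k IH] a; split=> //.
- by move=> x _; exact: cst_continuous.
- by move=> x _; exact: cst_continuous.
move=> i; split=> [x _|]; first exact: derivable_cst.
by apply: eq_Ck (IH 0) => // x _; rewrite derive_cst.
Qed.

Lemma CkD k V f g : open V -> Ck k V f -> Ck k V g ->
  Ck k V (fun x => f x + g x).
Proof.
move=> oV; elim: k f g => [|k IH] f g /CkE[cf Hf] /CkE[cg Hg].
  by split=> // x Vx; exact: continuousD (cf x Vx) (cg x Vx).
split=> [x Vx|i]; first by exact: continuousD (cf x Vx) (cg x Vx).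
have [df Df] := Hf i; have [dg Dg] := Hg i; split=> [x Vx|].
  by apply: derivableD; [exact: df|exact: dg].
apply: eq_Ck (IH _ _ Df Dg) => // x Vx.
by rewrite -deriveD//; [exact: df|exact: dg].
Qed.

Lemma CkM k V f g : open V -> Ck k V f -> Ck k V g ->
  Ck k V (fun x => f x * g x).
Proof.
move=> oV; elim: k f g => [|k IH] f g Cf Cg; have [cf Hf] := CkE Cf;
  have [cg Hg] := CkE Cg.
  by split=> // x Vx; exact: continuousM (cf x Vx) (cg x Vx).
split=> [x Vx|i]; first by exact: continuousM (cf x Vx) (cg x Vx).
have [df Df] := Hf i; have [dg Dg] := Hg i; split=> [x Vx|].
  by apply: derivableM; [exact: df|exact: dg].
apply: eq_Ck (CkD oV (IH _ _ (CkW Cf) Dg) (IH _ _ (CkW Cg) Df)) => // x Vx.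
by rewrite deriveM//; [exact: df|exact: dg].
Qed.

Lemma Cinfty_cst V (a : R) : open V -> Cinfty V (fun=> a).
Proof. by move=> oV k; exact: Ck_cst. Qed.

Lemma CinftyD V f g : open V -> Cinfty V f -> Cinfty V g ->
  Cinfty V (fun x => f x + g x).
Proof. by move=> oV Cf Cg k; apply: CkD. Qed.

Lemma CinftyM V f g : open V -> Cinfty V f -> Cinfty V g ->
  Cinfty V (fun x => f x * g x).
Proof. by move=> oV Cf Cg k; apply: CkM. Qed.

End SmoothRn.

(* Only the values of [chart_map] on [chart_dom] and of [chart_inv] on the image
   of [chart_dom] are meaningful. *)
Record chart (R : realType) (n : nat) (T : topologicalType) := Chart {
  chart_dom : set T;
  chart_map : T -> 'rV[R]_n;
  chart_inv : 'rV[R]_n -> T;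
  chart_dom_open : open chart_dom;
  chart_img_open : open (chart_map @` chart_dom);
  chart_mapK : forall p, chart_dom p -> chart_inv (chart_map p) = p;
  chart_map_continuous : forall p, chart_dom p -> {for p, continuous chart_map};
  chart_inv_continuous : forall x, (chart_map @` chart_dom) x ->
    {for x, continuous chart_inv} }.

Record smoothManifold (R : realType) (n : nat) := SmoothManifold {
  carrier :> topologicalType;
  carrier_hausdorff : hausdorff_space carrier;
  carrier_second_countable : @second_countable carrier;
  atlas : set (chart R n carrier);
  atlas_cover : forall p, exists2 c, atlas c & chart_dom c p;
  atlas_smooth : forall c c', atlas c -> atlas c' -> forall i : 'I_n,
    Cinfty (chart_map c @` (chart_dom c `&` chart_dom c'))
      (fun x => chart_map c' (chart_inv c x) 0 i) }.

Section SmoothFunctions.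
Variables (R : realType) (n : nat) (M : smoothManifold R n).

Definition smooth (f : M -> R) : Prop :=
  forall c, atlas c ->
    Cinfty (chart_map c @` chart_dom c) (fun x => f (chart_inv c x)).

Definition smoothb : {pred M -> R} := fun f => `[< smooth f >].

Lemma smooth_subring : subring_closed smoothb.
Proof.
have sM (f g : M -> R) : smooth f -> smooth g -> smooth (f * g).
  by move=> sf sg c Ac; apply: CinftyM (sf _ Ac) (sg _ Ac);
     exact: chart_img_open.
have sC (a : R) : smooth (fun=> a).
  by move=> c Ac; apply: Cinfty_cst; exact: chart_img_open.
have sD (f g : M -> R) : smooth f -> smooth g -> smooth (f + g).
  by move=> sf sg c Ac; apply: CinftyD (sf _ Ac) (sg _ Ac);
     exact: chart_img_open.
split=> [|f g /asboolP sf /asboolP sg|f g /asboolP sf /asboolP sg];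
  apply/asboolP; [exact: sC| |exact: sM].
apply: sD => //; suff -> : - g = (fun=> -1) * g by exact: sM.
by apply/funext => x; rewrite /GRing.mul/= mulN1r.
Qed.

HB.instance Definition _ :=
  GRing.isSubringClosed.Build (M -> R) smoothb smooth_subring.

(* The ring C^oo(M). *)
Record smoothFun := SmoothFun {
  smooth_val :> M -> R;
  smooth_valP : smooth_val \in smoothb }.

HB.instance Definition _ := [isSub for smooth_val].
HB.instance Definition _ := [Choice of smoothFun by <:].
HB.instance Definition _ := 
  GRing.SubChoice_isSubComPzRing.Build _ _ smoothFun (subringClosedP _).

Lemma smooth_cst_subproof (a : R) : (@cst M R a) \in smoothb.
Proof.
by apply/asboolP => c Ac; apply: Cinfty_cst; exact: chart_img_open.
Qed.

Definition smooth_cst (a : R) : smoothFun :=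
  SmoothFun (smooth_cst_subproof a).

End SmoothFunctions.

Lemma lie_bracket_alg (V : comPzRingType) (a b c d e k : V) :
  a + b + (c + d) - (e + d + (k + b)) = a - e + (c - k).
Proof. ring. Qed.

Lemma nabla_form_alg (V : comPzRingType) (u p q x r s t : V) :
  u * p + q * x + r - (x * q + u * s + t) = u * (p - s) + (r - t).
Proof. ring. Qed.

Section VectorFields.
Variables (R : realType) (n : nat) (M : smoothManifold R n).
Local Notation C := (smoothFun M).

Definition derivation (D : C -> C^o) : Prop :=
  [/\ {morph D : f g / f + g},
      forall (a : R) f, D (smooth_cst M a * f) = smooth_cst M a * D f &
      forall f g, D (f * g) = f * D g + g * D f].

Definition derivationb : {pred C -> C^o} := fun D => `[< derivation D >].

Lemma derivation_submod : subsemimod_closed derivationb.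
Proof.
split; first split.
- apply/asboolP; split=> [f g|a f|f g]; first by rewrite [RHS]addr0.
  + by rewrite [RHS]mulr0.
  + by rewrite [X in _ = X + _]mulr0 [X in _ = _ + X]mulr0 addr0.
- move=> D D' /asboolP[Da Dl DM] /asboolP[Da' Dl' DM'].
  have E f : (D + D') f = D f + D' f by [].
  apply/asboolP; split=> [f g|a f|f g]; rewrite !E.
  + by rewrite Da Da' addrACA.
  + by rewrite Dl Dl' -mulrDr.
  + by rewrite DM DM' addrACA -!mulrDr.
- move=> u D /asboolP[Da Dl DM].
  have E f : (u *: D) f = u * D f by [].
  apply/asboolP; split=> [f g|a f|f g]; rewrite !E.
  + by rewrite Da mulrDr.
  + by rewrite Dl mulrCA.
  + by rewrite DM mulrDr [u * (f * _)]mulrCA [u * (g * _)]mulrCA.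
Qed.

HB.instance Definition _ :=
  GRing.isSubmodClosed.Build C (C -> C^o) derivationb derivation_submod.

(* The C^oo(M)-module of vector fields on M, as derivations of C^oo(M). *)
Record vfield := VField {
  vfield_val :> C -> C^o;
  vfield_valP : vfield_val \in derivationb }.

HB.instance Definition _ := [isSub for vfield_val].
HB.instance Definition _ := [Choice of vfield by <:].
HB.instance Definition _ := [SubChoice_isSubLmodule of vfield by <:].

Lemma vfieldP (X : vfield) : derivation X.
Proof. exact/asboolP/vfield_valP. Qed.

Lemma vfieldB (X : vfield) f g : X (f - g) = X f - X g.
Proof.
have [XD _ _] := vfieldP X.
by apply: (addIr (X g)); rewrite -XD !subrK.
Qed.

Lemma lie_bracket_subproof (X Y : vfield) :
  (fun f => X (Y f) - Y (X f)) \in derivationb.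
Proof.
have [XD XZ XM] := vfieldP X; have [YD YZ YM] := vfieldP Y.
apply/asboolP; split=> [f g|a f|f g].
- by rewrite YD XD XD YD opprD addrACA.
- by rewrite YZ XZ XZ YZ mulrBr.
- rewrite YM XM XD YD !XM !YM !mulrBr [Y g * X f]mulrC [X g * Y f]mulrC.
  move: (f * X (Y g)) (X f * Y g) (g * X (Y f)) (Y f * X g) (f * Y (X g)).
  by move: (g * Y (X f)) => k a b c d e; rewrite lie_bracket_alg.
Qed.

Definition lie_bracket (X Y : vfield) : vfield :=
  VField (lie_bracket_subproof X Y).

Definition linear_form (b : vfield -> C^o) : Prop :=
  forall (u : C) X Y, b (u *: X + Y) = u * b X + b Y.

Definition linear_formb : {pred vfield -> C^o} := fun b => `[< linear_form b >].

Lemma linear_form_submod : subsemimod_closed linear_formb.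
Proof.
split; first split.
- by apply/asboolP => u X Y; rewrite [X in _ = X + _]mulr0 addr0.
- move=> b c /asboolP Lb /asboolP Lc; apply/asboolP => u X Y.
  have E Z : (b + c) Z = b Z + c Z by [].
  by rewrite !E Lb Lc addrACA -mulrDr.
- move=> v b /asboolP Lb; apply/asboolP => u X Y.
  have E Z : (v *: b) Z = v * b Z by [].
  by rewrite !E Lb mulrDr mulrCA.
Qed.

HB.instance Definition _ :=
  GRing.isSubmodClosed.Build C (vfield -> C^o) linear_formb linear_form_submod.

(* The C^oo(M)-module of 1-forms, as C^oo(M)-linear functionals on vector
   fields. *)
Record oneForm := OneForm {
  oneForm_val :> vfield -> C^o;
  oneForm_valP : oneForm_val \in linear_formb }.

HB.instance Definition _ := [isSub for oneForm_val].
HB.instance Definition _ := [Choice of oneForm by <:].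
HB.instance Definition _ := [SubChoice_isSubLmodule of oneForm by <:].

Lemma oneFormP (b : oneForm) : linear_form b.
Proof. exact/asboolP/oneForm_valP. Qed.

Record tensor02 := Tensor02 {
  tensor_val :> vfield -> vfield -> C;
  tensor_linearl : forall Y (u : C) X X',
    tensor_val (u *: X + X') Y = u * tensor_val X Y + tensor_val X' Y;
  tensor_linearr : forall X (u : C) Y Y',
    tensor_val X (u *: Y + Y') = u * tensor_val X Y + tensor_val X Y' }.

Record affineConnection := AffineConnection {
  nabla_val :> vfield -> vfield -> vfield;
  nabla_linearl : forall Z (u : C) X Y,
    nabla_val (u *: X + Y) Z = u *: nabla_val X Z + nabla_val Y Z;
  nabla_additive : forall X Y Z,
    nabla_val X (Y + Z) = nabla_val X Y + nabla_val X Z;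
  nabla_leibniz : forall X (u : C) Y,
    nabla_val X (u *: Y) = X u *: Y + u *: nabla_val X Y }.

(* The tangent space at p is the set of values at p of global vector fields
   (every tangent vector extends to one), so this is the nondegeneracy of every
   bilinear form h_p. *)
Definition nondegenerate_tensor (h : tensor02) : Prop :=
  forall (p : M) (X : vfield),
    (forall Y, h X Y p = 0) -> (forall f : C, (X f : C) p = 0).

Definition symmetric_tensor (h : tensor02) : Prop := forall X Y, h X Y = h Y X.

Lemma flat_subproof (h : tensor02) (X : vfield) :
  (fun Y => h X Y : C^o) \in linear_formb.
Proof. by apply/asboolP => u Y Z; exact: tensor_linearr. Qed.

Definition flat (h : tensor02) (X : vfield) : oneForm :=
  OneForm (flat_subproof h X).

(* h^{-1}(b): for nondegenerate h there is exactly one vector field X with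
   h(X) = b; the default 0 is never used. *)
Definition sharp (h : tensor02) (b : oneForm) : vfield :=
  xget 0 [set X | flat h X = b].

Lemma nabla_form_subproof (nabla : affineConnection) (X : vfield) (b : oneForm) :
  (fun Y => X (b Y : C) - b (nabla X Y)) \in linear_formb.
Proof.
have [XD _ XM] := vfieldP X; have Lb := oneFormP b.
have bD Y Z : b (Y + Z) = b Y + b Z by have := Lb 1 Y Z; rewrite scale1r mul1r.
have b0 : b 0 = 0 by apply: (addIr (b 0)); rewrite -bD !add0r.
have bZ u Y : b (u *: Y) = u * b Y by have := Lb u Y 0; rewrite b0 !addr0.
apply/asboolP => u Y Z.
rewrite Lb nabla_additive nabla_leibniz !bD !bZ XD XM.
exact: nabla_form_alg.
Qed.

Definition nabla_form (nabla : affineConnection) (X : vfield) (b : oneForm) :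
  oneForm := OneForm (nabla_form_subproof nabla X b).

Definition nabla_tensor (nabla : affineConnection) (h : tensor02)
    (X Y Z : vfield) : C :=
  X (h Y Z) - h (nabla X Y) Z - h Y (nabla X Z).

Definition parallel (nabla : affineConnection) (h : tensor02) : Prop :=
  forall X Y Z, nabla_tensor nabla h X Y Z = 0.

Definition curvature (nabla : affineConnection) (X Y Z : vfield) : vfield :=
  nabla X (nabla Y Z) - nabla Y (nabla X Z) - nabla (lie_bracket X Y) Z.

(* Sections of TM (+) T*M; the section X + eta is the pair (X, eta). *)
Definition section : Type := (vfield * oneForm)%type.

HB.instance Definition _ := GRing.Lmodule.on section.

Definition section_bracket (nabla : affineConnection) (s t : section) : section :=
  (lie_bracket s.1 t.1, nabla_form nabla s.1 t.2 - nabla_form nabla t.1 s.2).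

Definition check_form (h : tensor02) (s t : section) : C :=
  h s.1 t.1 + h (sharp h s.2) (sharp h t.2).

Definition hat_nabla (nabla : affineConnection) (h : tensor02)
    (s t : section) : section :=
  (nabla s.1 t.1, flat h (nabla s.1 (sharp h t.2))).

Definition hat_nabla_dual (nabla : affineConnection) (h : tensor02)
    (s t : section) : section :=
  (sharp h (nabla_form nabla s.1 (flat h t.1)), nabla_form nabla s.1 t.2).

Definition hat_nabla_alpha (nabla : affineConnection) (h : tensor02) (a : R)
    (s t : section) : section :=
  smooth_cst M ((1 + a) / 2) *: hat_nabla nabla h s t
  + smooth_cst M ((1 - a) / 2) *: hat_nabla_dual nabla h s t.

Definition section_curvature (nabla : affineConnection)
    (D : section -> section -> section) (s t v : section) : section :=
  D s (D t v) - D t (D s v) - D (section_bracket nabla s t) v.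

(* A local h-orthonormal frame on the open set U. The local fields are given by
   global vector fields of which only the restriction to U matters; near any
   given point every local frame is of this form. *)
Definition orthonormal_frame (h : tensor02) (U : set M) (E : 'I_n -> vfield) :
    Prop :=
  [/\ open U,
      (forall p, U p -> forall X : vfield, exists a : 'I_n -> R,
         forall f : C, (X f : C) p = \sum_(i < n) a i * (E i f : C) p),
      (forall p, U p -> forall i, h (E i) (E i) p = 1 \/ h (E i) (E i) p = -1) &
      (forall p, U p -> forall i j, i != j -> h (E i) (E j) p = 0)].

(* The sum defining Ric is computed from the frame E; it is the Ricci tensor
   at the points of an open set on which E is h-orthonormal. *)
Definition ricci (nabla : affineConnection) (h : tensor02) (E : 'I_n -> vfield)
    (Y Z : vfield) : C :=
  \sum_(i < n) h (E i) (E i) * h (curvature nabla (E i) Y Z) (E i).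

Definition e_plus (h : tensor02) (X : vfield) : section :=
  smooth_cst M (Num.sqrt 2)^-1 *: ((X, flat h X) : section).

Definition e_minus (h : tensor02) (X : vfield) : section :=
  smooth_cst M (Num.sqrt 2)^-1 *: ((X, - flat h X) : section).

Definition section_ricci (nabla : affineConnection) (h : tensor02)
    (D : section -> section -> section) (E : 'I_n -> vfield) (s v : section) :
    C :=
  \sum_(i < n) h (E i) (E i) *
    (check_form h (section_curvature nabla D (e_plus h (E i)) s v)
                  (e_plus h (E i)) +
     check_form h (section_curvature nabla D (e_minus h (E i)) s v)
                  (e_minus h (E i))).

(* The condition Ric^D = Ric^{D'} on a pair (D, D') of check_form-dual
   connections, read off in every local orthonormal frame. *)
Definition conjugate_ricci_symmetric (nabla : affineConnection) (h : tensor02)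
    (D D' : section -> section -> section) : Prop :=
  forall (U : set M) (E : 'I_n -> vfield), orthonormal_frame h U E ->
  forall (s v : section) (p : M), U p ->
    section_ricci nabla h D E s v p = section_ricci nabla h D' E s v p.

End VectorFields.

(* Main.v *)
(* The curvature of a connection D on TM (+) T*M whose vector part is
   (D_s t).1 = nabla_(s.1) t.1 has the curvature of nabla as vector part, and it
   depends on its first argument only through the vector part of that argument,
   provided D does.
   So R^D(e_i^+, s) v = R^D(e_i^-, s) v; pairing it with e_i^+ and with e_i^-,
   the covector contributions cancel and the vector contributions add up to
   h(R^nabla(E_i, s.1) v.1, E_i). When nabla h = 0, nabla commutes with flat,
   which gives the vector part of hat_nabla_alpha. Since the covector parts cancel
   whatever they are, only the values of sharp on the range of flat matter, where
   injectivity of flat determines it. *)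
Require Import Defs.
From mathcomp Require Import all_boot all_order all_algebra.
From mathcomp Require Import all_classical all_reals all_analysis.

Import GRing.Theory Num.Theory.

Local Open Scope classical_set_scope.
Local Open Scope ring_scope.

Section Constants.
Variables (R : realType) (n : nat) (M : smoothManifold R n).

Lemma smooth_cst1 : smooth_cst M 1 = 1.
Proof. exact: val_inj. Qed.

Lemma smooth_cstD (a b : R) :
  smooth_cst M (a + b) = smooth_cst M a + smooth_cst M b.
Proof. exact: val_inj. Qed.

Lemma smooth_cstM (a b : R) :
  smooth_cst M (a * b) = smooth_cst M a * smooth_cst M b.
Proof. exact: val_inj. Qed.

End Constants.

Section Tensors.
Variables (R : realType) (n : nat) (M : smoothManifold R n) (h : tensor02 M).

Lemma tensorDr X Y Z : h X (Y + Z) = h X Y + h X Z.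
Proof. by have := tensor_linearr h X 1 Y Z; rewrite scale1r mul1r. Qed.

Lemma tensor0l X : h 0 X = 0.
Proof.
have := tensor_linearl h X 1 0 0; rewrite scale1r mul1r addr0 => E.
by apply: (addIr (h 0 X)); rewrite add0r -E.
Qed.

Lemma tensor0r X : h X 0 = 0.
Proof. by apply: (addIr (h X 0)); rewrite -tensorDr !add0r. Qed.

Lemma tensorZl u X Y : h (u *: X) Y = u * h X Y.
Proof. by have := tensor_linearl h Y u X 0; rewrite tensor0l !addr0. Qed.

Lemma tensorZr u X Y : h X (u *: Y) = u * h X Y.
Proof. by have := tensor_linearr h X u Y 0; rewrite tensor0r !addr0. Qed.

Lemma tensorNr X Y : h X (- Y) = - h X Y.
Proof. by rewrite -scaleN1r tensorZr mulN1r. Qed.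

Lemma tensorBl X Y Z : h (X - Y) Z = h X Z - h Y Z.
Proof. by rewrite addrC -scaleN1r tensor_linearl mulN1r addrC. Qed.

Lemma flatZ u X : flat h (u *: X) = u *: flat h X.
Proof. by apply/val_inj/funext => Y; exact: tensorZl. Qed.

Lemma flatN X : flat h (- X) = - flat h X.
Proof. by rewrite -scaleN1r flatZ scaleN1r. Qed.

Hypothesis h_nondeg : nondegenerate_tensor h.

(** Nondegeneracy at each point [p] makes [X - Y] kill every function at [p]; a vector field is a
    derivation, so it is then zero. *)
Lemma flat_inj : injective (flat h).
Proof.
move=> X Y XY; apply/eqP; rewrite -subr_eq0; apply/eqP.
apply/val_inj/funext => f; apply/val_inj/funext => p.
apply: (h_nondeg p) => Z; rewrite tensorBl.
have -> : h X Z = h Y Z by exact: (congr1 (fun b : oneForm M => b Z) XY).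
by rewrite subrr.
Qed.

Lemma flatK : cancel (flat h) (sharp h).
Proof.
move=> X; apply: flat_inj.
(* [X] itself shows that the set defining [sharp h (flat h X)] is inhabited, so the default 0 is not
   taken. *)
by apply: (@xgetPex _ 0 [set Y | flat h Y = flat h X]); exists X.
Qed.

End Tensors.

Section Curvature.
Variables (R : realType) (n : nat) (M : smoothManifold R n).
Variable nabla : affineConnection M.

Lemma nablaDl X Y Z : nabla (X + Y) Z = nabla X Z + nabla Y Z.
Proof. by have := nabla_linearl nabla Z 1 X Y; rewrite !scale1r. Qed.

Lemma nabla0l Z : nabla 0 Z = 0.
Proof. by apply: (addIr (nabla 0 Z)); rewrite -nablaDl !add0r. Qed.

Lemma nablaZl u X Z : nabla (u *: X) Z = u *: nabla X Z.
Proof. by have := nabla_linearl nabla Z u X 0; rewrite nabla0l !addr0. Qed.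

Lemma nablaBl X Y Z : nabla (X - Y) Z = nabla X Z - nabla Y Z.
Proof. by rewrite nablaDl -[- Y]scaleN1r nablaZl scaleN1r. Qed.

Lemma lie_bracketZl u (X Y : vfield M) :
  lie_bracket (u *: X) Y = u *: lie_bracket X Y - Y u *: X.
Proof.
have [_ _ YM] := vfieldP Y.
apply/val_inj/funext => f.
have -> : val (lie_bracket (u *: X) Y) f = u * X (Y f) - Y (u * X f) by [].
have -> : val (u *: lie_bracket X Y - Y u *: X) f
  = u * (X (Y f) - Y (X f)) - Y u * X f by [].
by rewrite YM mulrBr opprD addrA [X f * _]mulrC.
Qed.

(** The term [Y u *: nabla X Z] arises twice, from the Leibniz rule for [nabla Y] and from the
    bracket, with opposite signs. This lets the factor of [e_plus] leave the curvature. *)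
Lemma curvatureZl u X Y Z :
  curvature nabla (u *: X) Y Z = u *: curvature nabla X Y Z.
Proof.
rewrite /curvature lie_bracketZl nablaBl !nablaZl nabla_leibniz !scalerBr.
set a := u *: nabla X _; set b := Y u *: _; set c := u *: nabla Y _.
by rewrite opprD opprB [- b - c]addrC !addrA subrK.
Qed.

End Curvature.

Section VectorPart.
Variables (R : realType) (n : nat) (M : smoothManifold R n).
Variables (nabla : affineConnection M) (h : tensor02 M).

(** Evaluated at [Z], the difference of the two sides is [nabla_tensor nabla h X Y Z]. *)
Lemma nabla_form_flat X Y :
  parallel nabla h -> nabla_form nabla X (flat h Y) = flat h (nabla X Y).
Proof.
move=> h_par; apply/val_inj/funext => Z.
apply/eqP; rewrite -subr_eq0; apply/eqP.
rewrite -[RHS](h_par X Y Z) /nabla_tensor /=.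
by rewrite -!addrA [- h Y _ - _]addrC.
Qed.

Hypothesis h_nondeg : nondegenerate_tensor h.

Lemma hat_nabla_alpha1 (alpha : R) s t : parallel nabla h ->
  (hat_nabla_alpha nabla h alpha s t).1 = nabla s.1 t.1.
Proof.
move=> h_par.
have -> : (hat_nabla_alpha nabla h alpha s t).1
  = smooth_cst M ((1 + alpha) / 2) *: nabla s.1 t.1
    + smooth_cst M ((1 - alpha) / 2)
      *: sharp h (nabla_form nabla s.1 (flat h t.1)) by [].
(* Both connections now have vector part [nabla s.1 t.1], and their weights add up to 1. *)
rewrite nabla_form_flat// flatK// -scalerDl -smooth_cstD -mulrDl addrACA subrr.
by rewrite addr0 divff ?pnatr_eq0// smooth_cst1 scale1r.
Qed.

Variable D : section M -> section M -> section M.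
Hypothesis D1 : forall s t, (D s t).1 = nabla s.1 t.1.
Hypothesis D_anchor : forall s s' t, s.1 = s'.1 -> D s t = D s' t.

Lemma section_curvature1 s t v :
  (section_curvature nabla D s t v).1 = curvature nabla s.1 t.1 v.1.
Proof. by rewrite /section_curvature /= !D1. Qed.

Lemma section_curvature_anchor s s' t v : s.1 = s'.1 ->
  section_curvature nabla D s t v = section_curvature nabla D s' t v.
Proof.
move=> ss'; rewrite /section_curvature !(D_anchor s s')//.
(* The covector part of the bracket does involve [s.2], but [D] sees only its vector part, a Lie
   bracket. *)
by congr (_ - _); apply: D_anchor; rewrite /= ss'.
Qed.

Lemma check_formDpm w X :
  check_form h w (e_plus h X) + check_form h w (e_minus h X)
  = smooth_cst M ((Num.sqrt 2)^-1 *+ 2) * h w.1 X.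
Proof.
rewrite /check_form /e_plus /e_minus /=.
rewrite scalerN -!flatZ -flatN !flatK// tensorNr addrACA subrr addr0.
by rewrite tensorZr -mulrDl mulr2n smooth_cstD.
Qed.

Lemma section_ricci_vector_part (E : 'I_n -> vfield M) s v :
  section_ricci nabla h D E s v = ricci nabla h E s.1 v.1.
Proof.
apply: eq_bigr => i _; congr (_ * _).
rewrite (section_curvature_anchor (e_minus h (E i)) (e_plus h (E i)))//.
rewrite check_formDpm section_curvature1 /= curvatureZl tensorZl mulrA.
(* One factor [(Num.sqrt 2)^-1] comes from the curvature slot and one, doubled, from the pairing:
   their product is 1. *)
rewrite -smooth_cstM mulrnAl -invfM -expr2 sqr_sqrtr// -mulr_natl.
by rewrite divff ?pnatr_eq0// smooth_cst1 mul1r.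
Qed.

End VectorPart.

Theorem proposition3p17 (R : realType) (n : nat) (M : smoothManifold R n)
    (nabla : affineConnection M) (h : tensor02 M)
    (h_nondeg : nondegenerate_tensor h) (h_sym : symmetric_tensor h)
    (h_par : parallel nabla h) (alpha : R) :
  (forall (U : set M) (E : 'I_n -> vfield M), orthonormal_frame h U E ->
   forall (Y Z : vfield M) (beta gamma : oneForm M) (p : M), U p ->
     section_ricci nabla h (hat_nabla_alpha nabla h alpha) E
       (Y, beta) (Z, gamma) p = ricci nabla h E Y Z p /\
     ricci nabla h E Y Z p =
     section_ricci nabla h (hat_nabla_alpha nabla h (- alpha)) E
       (Y, beta) (Z, gamma) p) /\
  conjugate_ricci_symmetric nabla h
    (hat_nabla_alpha nabla h alpha) (hat_nabla_alpha nabla h (- alpha)).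
Proof.
(* The right-hand side is free of [a], so [alpha] and [- alpha] give the same value. *)
have ricE a E s v : section_ricci nabla h (hat_nabla_alpha nabla h a) E s v
    = ricci nabla h E s.1 v.1.
  apply: section_ricci_vector_part => // [s' t|s1 s2 t s12].
    exact: hat_nabla_alpha1.
  by rewrite /hat_nabla_alpha /hat_nabla /hat_nabla_dual s12.
by split=> [U E _ Y Z beta gamma p _|U E _ s v p _]; rewrite !ricE.
Qed.
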